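(* Let $Q$ be a convex polytope in $\mathbb{R}^d$ containing the Euclidean unit ball $\mathbf{B}^d$. Then there are at most $2d$ vertices of $Q$ whose convex hull $Q'$ satisfies \[ \frac{d^{-5/2}}{7}\,\mathbf{B}^d \subset Q'. \]
   Context: $\mathbf{B}^d$ denotes the standard closed Euclidean unit ball in $\mathbb{R}^d$ centered at the origin, and $t\,\mathbf{B}^d$ is its dilate by the factor $t$. A convex polytope is the convex hull of finitely many points. Here $d$ is a positive integer. *)

(* Defs.v *)
From HB Require Import structures.
From mathcomp Require Import all_boot all_order all_algebra finmap.
From mathcomp Require Import boolp classical_sets reals convex exp.
Set Implicit Arguments.
Unset Strict Implicit.
Unset Printing Implicit Defensive.
Import Order.TTheory GRing.Theory Num.Theory.
Local Open Scope classical_set_scope.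
Local Open Scope ring_scope.

(* The canonical norm `|x| on 'rV[R]_d is the sup norm, hence this definition. *)
Definition euclidean_norm (R : realType) (d : nat) (x : 'rV[R]_d) : R :=
  Num.sqrt (\sum_(i < d) x 0 i ^+ 2).

Definition euclidean_ball (R : realType) (d : nat) : set 'rV[R]_d :=
  [set x | euclidean_norm x <= 1].
Arguments euclidean_ball : clear implicits.

Definition dilate (R : realType) (d : nat) (t : R) (A : set 'rV[R]_d) :
    set 'rV[R]_d :=
  [set t *: x | x in A].

Definition convex_hull (R : realType) (d : nat) (A : set 'rV[R]_d) :
    set 'rV[R]_d :=
  smallest (@convex_set R 'rV[R]_d) A.

Definition polytope (R : realType) (d : nat) (Q : set 'rV[R]_d) : Prop :=
  exists V : {fset 'rV[R]_d}, Q = convex_hull [set` V].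

(* The vertices of a polytope, as its extreme points. *)
Definition vertices (R : realType) (d : nat) (Q : set 'rV[R]_d) :
    set 'rV[R]_d :=
  [set x | Q x /\ forall (y z : 'rV[R]_d) (t : R), Q y -> Q z ->
     0 < t < 1 -> x = t *: y + (1 - t) *: z -> y = x /\ z = x].

(* Main.v *)
Require Import Defs.
From HB Require Import structures.
From mathcomp Require Import all_boot all_order all_algebra perm finmap.
From mathcomp Require Import boolp classical_sets reals convex exp.
From mathcomp Require Import interval_inference ring lra.
Set Implicit Arguments.
Unset Strict Implicit.
Unset Printing Implicit Defensive.
Import Order.TTheory GRing.Theory Num.Theory.
Local Open Scope classical_set_scope.
Local Open Scope ring_scope.

(** The proof works with the polar body. Let W be the set of vertices of Q and
let K be the set of the x with <v, x> <= 1 for every v in W. Since Q contains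
the unit ball, <p, x> <= 1 for every x in K and every p in the ball; by Farkas'
lemma it is enough to find at most 2d vertices whose polar K' satisfies
<p, x> <= 7 d^(5/2) for every x in K' and every p in the ball
([ball_sub_convex_hull]).

The gain in passing to the polar is that a bound on K' does not depend on the
choice of an origin, so the origin can be moved to a point z at which K is
nearly as symmetric as a simplex: z - (x - z) / D is in K for every x in K,
with D close to d. The centroid of a simplex of nearly maximal volume in K is
such a point, because the barycentric coordinates of a point of K in that
simplex are at most 1 + e ([near_center]).

Seen from z, the body K is cut out by <g_v, x - z> <= 1, where g_v is a positive
multiple of v. Take w_1, ..., w_d among the g_v with |det| nearly maximal, so
that each g_v is a combination of the w_j with coefficients in
[-(1 + e), 1 + e]. The near symmetry of K bounds y = - (w_1 + ... + w_d) by d D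
on K - z, so by Farkas' lemma y is a nonnegative combination of the g_v with
coefficients of sum at most d D, and Caratheodory's reduction leaves at most d
terms in it. Keep the d vertices behind the w_j and the at most d vertices of
this combination. If x satisfies the inequalities of these vertices, then each
s_j = <w_j, x - z> is at most 1 and their sum is at least - d D, which gives
<g_v, x - z> <= C with C = (1 + e) d (D + 2) for every v. Therefore K' is
contained in z + C (K - z) ([sparse_polar]).

A point of K' is then C k - (C - 1) z with k and z in K, and its product with a
point of the ball is at most 2 C - 1. For e = 1/10 this is at most 7 d^2, hence
at most 7 d^(5/2).

Determinants are maximized only up to a factor 1 + e because the supremum over
a bounded spanning set ([near_maximal_basis]) can be approached without any
closedness of the set; the constant 7 leaves room for this loss. *)

(** * Inner product *)

Definition dot (R : realType) (n : nat) (u v : 'rV[R]_n) : R :=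
  \sum_(j < n) u 0 j * v 0 j.

Section Dot.
Variables (R : realType) (n : nat).
Implicit Types (u v w : 'rV[R]_n) (a : R).

Lemma dotC u v : dot u v = dot v u.
Proof. by apply: eq_bigr => j _; rewrite mulrC. Qed.

Lemma dotDl u v w : dot (u + v) w = dot u w + dot v w.
Proof. by rewrite -big_split; apply: eq_bigr => j _; rewrite mxE mulrDl. Qed.

Lemma dotZl a u v : dot (a *: u) v = a * dot u v.
Proof. by rewrite mulr_sumr; apply: eq_bigr => j _; rewrite mxE mulrA. Qed.

Lemma dotDr u v w : dot w (u + v) = dot w u + dot w v.
Proof. by rewrite ![dot w _]dotC dotDl. Qed.

Lemma dotZr a u v : dot v (a *: u) = a * dot v u.
Proof. by rewrite ![dot v _]dotC dotZl. Qed.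

Lemma dotNl u v : dot (- u) v = - dot u v.
Proof. by rewrite -scaleN1r dotZl mulN1r. Qed.

Lemma dotNr u v : dot v (- u) = - dot v u.
Proof. by rewrite ![dot v _]dotC dotNl. Qed.

Lemma dot0r u : dot u 0 = 0.
Proof. by rewrite -(scale0r 0) dotZr mul0r. Qed.

Lemma dot_suml (I : Type) (s : seq I) (P : pred I) (f : I -> 'rV[R]_n) v :
  dot (\sum_(i <- s | P i) f i) v = \sum_(i <- s | P i) dot (f i) v.
Proof.
elim/big_rec2: _ => [|i x u _ <-]; first by rewrite dotC dot0r.
by rewrite dotDl.
Qed.

Lemma dot_sumr (I : Type) (s : seq I) (P : pred I) (f : I -> 'rV[R]_n) v :
  dot v (\sum_(i <- s | P i) f i) = \sum_(i <- s | P i) dot v (f i).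
Proof. by rewrite dotC dot_suml; apply: eq_bigr => i _; rewrite dotC. Qed.

Lemma dot_delta u (j : 'I_n) : dot u (delta_mx 0 j) = u 0 j.
Proof.
rewrite /dot (bigD1 j) //= mxE !eqxx mulr1 big1 ?addr0 // => k kj.
by rewrite mxE (negbTE kj) andbF mulr0.
Qed.

Lemma dotvv_gt0 u : u != 0 -> 0 < dot u u.
Proof.
move=> u0; rewrite lt_neqAle; apply/andP; split; last first.
  by apply: sumr_ge0 => j _; rewrite -expr2 sqr_ge0.
apply: contra u0 => /eqP/esym/psumr_eq0P-H.
apply/eqP/rowP=> j; rewrite [RHS]mxE; apply/eqP.
by rewrite -sqrf_eq0 expr2; apply/eqP/H => // k _; rewrite -expr2 sqr_ge0.
Qed.

End Dot.

Lemma dot_row_mx (R : realType) (m n : nat) (u u' : 'rV[R]_m) (v v' : 'rV[R]_n) :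
  dot (row_mx u v) (row_mx u' v') = dot u u' + dot v v'.
Proof.
rewrite /dot big_split_ord; congr (_ + _); apply: eq_bigr => j _.
  by rewrite !row_mxEl.
by rewrite !row_mxEr.
Qed.

(** * Farkas' lemma and Caratheodory's reduction *)

(** Induction on the family. If the separating x found for the tail of the
family is positive on the new vector f i, project along f i onto the hyperplane
orthogonal to x and use the induction hypothesis for the projected vectors: a
combination lifts back with a nonnegative coefficient on f i because x
separates, and a separating vector for the projections becomes one for the
family after it is made orthogonal to f i. *)
Lemma farkas_seq (R : realType) (n : nat) (I : eqType) (s : seq I)
    (f : I -> 'rV[R]_n) (y : 'rV[R]_n) : uniq s ->
  (exists c : I -> R, (forall i, 0 <= c i) /\ y = \sum_(i <- s) c i *: f i) \/
  (exists x, (forall i, i \in s -> dot (f i) x <= 0) /\ 0 < dot y x).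
Proof.
elim: s f y => [|i s IHs] f y /=.
  have [->|y0] := eqVneq y 0; first by left; exists (fun=> 0); rewrite big_nil.
  by right; exists y; split=> //; exact: dotvv_gt0.
case/andP=> si us.
have extend c0 c : 0 <= c0 -> (forall j, 0 <= c j) ->
    y = c0 *: f i + \sum_(j <- s) c j *: f j ->
    exists c' : I -> R, (forall j, 0 <= c' j) /\
      y = \sum_(j <- i :: s) c' j *: f j.
  move=> c0_ge0 c_ge0 ->; exists (fun j => if j == i then c0 else c j).
  split=> [j|]; first by case: ifP.
  rewrite big_cons eqxx; congr (_ + _).
  by apply: eq_big_seq => j js; case: eqP js si => // -> ->.
case: (IHs f y us) => [[c [c_ge0 Ey]]|[x [xs yx]]].
  by left; apply: (extend 0 c) => //; rewrite scale0r add0r.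
have [fix_le0|fix_gt0] := leP (dot (f i) x) 0.
  by right; exists x; split=> // j /predU1P[->//|]; exact: xs.
(* The projection along f i onto the hyperplane orthogonal to x. *)
pose P u := u - (dot u x / dot (f i) x) *: f i.
case: (IHs (P \o f) (P y) us) => [[c [c_ge0 Ey]]|[x' [x's yx']]].
  left; pose c0 := (dot y x - \sum_(j <- s) c j * dot (f j) x) / dot (f i) x.
  apply: (extend c0 c) => //.
    apply: divr_ge0; last exact: ltW.
    rewrite subr_ge0; apply: le_trans (ltW yx); rewrite big_seq sumr_le0 // => j js.
    by rewrite mulr_ge0_le0 // xs.
  move: Ey => /(canRL (subrK _)) ->; rewrite addrC.
  rewrite (eq_bigr (fun j =>
    c j *: f j - (c j * dot (f j) x / dot (f i) x) *: f i)); last first.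
    by move=> j _; rewrite /= /P scalerBr scalerA mulrA.
  rewrite sumrB -scaler_suml addrA addrAC -scalerBl /c0 mulrBl.
  rewrite [X in (_ - X) *: _ + _ = _](_ : _ =
    (\sum_(j <- s) c j * dot (f j) x) / dot (f i) x) //.
  by rewrite mulr_suml.
right; exists (x' - (dot (f i) x' / dot (f i) x) *: x).
have E u : dot u (x' - (dot (f i) x' / dot (f i) x) *: x) = dot (P u) x'.
  by rewrite dotDr dotDl !dotNr !dotNl dotZr dotZl; ring.
split=> [j|]; last by rewrite E.
rewrite E => /predU1P[->|]; last exact: x's.
by rewrite /P divff ?gt_eqF // scale1r subrr dotC dot0r.
Qed.

Lemma farkas (R : realType) (n : nat) (I : finType)
    (f : I -> 'rV[R]_n) (y : 'rV[R]_n) :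
  (exists c : I -> R, (forall i, 0 <= c i) /\ y = \sum_i c i *: f i) \/
  (exists x, (forall i, dot (f i) x <= 0) /\ 0 < dot y x).
Proof.
have [[c [c_ge0 ->]]|[x [xs yx]]] := farkas_seq f y (index_enum_uniq I).
  by left; exists c.
by right; exists x; split=> // i; apply: xs; rewrite mem_index_enum.
Qed.

(** While more than n coefficients are nonzero there is a linear relation e
between the vectors in use, which can be chosen with nonpositive sum. Moving
along e until a coefficient vanishes keeps the vector and does not increase the
sum of the coefficients. *)
Lemma conic_caratheodory (R : realType) (n : nat) (I : finType)
    (f : I -> 'rV[R]_n) (c : I -> R) : (forall i, 0 <= c i) ->
  exists c' : I -> R,
    [/\ forall i, 0 <= c' i, \sum_i c' i *: f i = \sum_i c i *: f i,
        \sum_i c' i <= \sum_i c i & (#|[pred i | c' i != 0%R]| <= n)%N].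
Proof.
have [k] := ubnP #|[pred i | c i != 0]|.
elim: k c => // k IHk c ck c_ge0.
set S := [pred i | c i != 0] in ck.
have [Sn|nS] := leqP #|S| n; first by exists c.
have [e [eS e0 ef]] : exists e : I -> R,
   [/\ forall i, i \notin S -> e i = 0, exists i, e i != 0
     & \sum_i e i *: f i = 0].
  pose A := \matrix_(a < #|S|) f (enum_val a).
  have /rowV0Pn[u uA u0] : kermx A != 0.
    rewrite kermx_eq0 /row_free neq_ltn.
    by rewrite (leq_ltn_trans (rank_leq_col A)).
  have [a ua] : exists a, u 0 a != 0.
    apply/existsP; apply: contraNT u0 => /existsPn-H.
    by apply/eqP/rowP=> a; rewrite [RHS]mxE; apply/eqP; rewrite -[_ == _]negbK H.
  (* u is indexed by the support of c; e is its extension by 0 to I. *)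
  pose e i := \sum_(b | enum_val b == i) u 0 b.
  have eE b : e (enum_val b) = u 0 b.
    rewrite /e (bigD1 b) //= big1 ?addr0 // => b' /andP[/eqP/enum_val_inj->].
    by rewrite eqxx.
  exists e; split.
  - move=> i iS; rewrite /e big_pred0 // => b; apply: contraNF iS => /eqP<-.
    exact: enum_valP.
  - by exists (enum_val a); rewrite eE.
  - move/sub_kermxP: uA; rewrite mulmx_sum_row => uA.
    rewrite -[RHS]uA; under eq_bigr do rewrite /e scaler_suml.
    rewrite (exchange_big_dep predT) //=; apply: eq_bigr => b _.
    rewrite rowK (big_pred1 (enum_val b)) // => i; exact: eq_sym.
wlog se_le0 : e eS e0 ef / \sum_i e i <= 0.
  move=> H; have [|se] := leP (\sum_i e i) 0; first exact: H eS e0 ef.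
  apply: (H (fun i => - e i)).
  - by move=> i /eS->; rewrite oppr0.
  - by case: e0 => i ei; exists i; rewrite oppr_eq0.
  - by under eq_bigr do rewrite scaleNr; rewrite sumrN ef oppr0.
  - by rewrite sumrN oppr_le0 ltW.
have [i0 ei0] : exists i, e i < 0.
  apply/existsP; apply: contrapT => /negP/existsPn-H.
  have ege i : true -> 0 <= e i by rewrite leNgt H.
  have : \sum_i e i = 0 by apply/eqP; rewrite eq_le se_le0 sumr_ge0.
  by move=> /psumr_eq0P-/(_ ege) E; case: e0 => i; rewrite E ?eqxx.
(* i1 is the coefficient that vanishes first when moving along e. *)
pose i1 := [arg min_(i < i0 | e i < 0) (c i / - e i)]%O.
have [ei1 min1] : e i1 < 0 /\ forall j, e j < 0 -> c i1 / - e i1 <= c j / - e j.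
  by rewrite /i1; case: arg_minP.
pose t := c i1 / - e i1; pose c1 i := c i + t * e i.
have t_ge0 : 0 <= t by rewrite divr_ge0 // oppr_ge0 ltW.
have c1_ge0 i : 0 <= c1 i.
  have [ei|ei] := ltP (e i) 0; last by apply: addr_ge0 => //; exact: mulr_ge0.
  by have := min1 i ei; rewrite -/t ler_pdivlMr ?oppr_gt0 // mulrN -subr_ge0 opprK.
have c1i1 : c1 i1 = 0.
  by rewrite /c1 /t invrN mulrN mulNr divfK ?lt_eqF // subrr.
have [|c' [c'_ge0 E1 E2 E3]] := IHk c1 _ c1_ge0.
  rewrite -ltnS; apply: leq_trans ck; rewrite ltnS; apply: proper_card.
  apply/properP; split.
    apply/fintype.subsetP=> i; rewrite !inE; apply: contraNneq => ci.
    by rewrite /c1 ci eS ?inE ?ci ?eqxx // mulr0 addr0.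
  exists i1; last by rewrite !inE c1i1 eqxx.
  by apply: contraTT ei1 => /eS->; rewrite ltxx.
exists c'; split=> //.
  rewrite E1 /c1; under eq_bigr do rewrite scalerDl -scalerA.
  by rewrite big_split /= -scaler_sumr ef scaler0 addr0.
apply: le_trans E2 _; rewrite /c1 big_split /= -mulr_sumr gerDl.
by rewrite mulr_ge0_le0.
Qed.

(** * Bases of nearly maximal determinant *)

(** The orthogonal-complement form of spanning is the one that can be checked
directly on polar bodies. *)
Definition spanning (R : realType) (n : nat) (X : set 'rV[R]_n) : Prop :=
  forall x, (forall u, X u -> dot u x = 0) -> x = 0.

Lemma mulmx_tr_dot (R : realType) (n : nat) (u v : 'rV[R]_n) :
  u *m v^T = (dot u v)%:M.
Proof.
by apply/rowP=> j; rewrite ord1 !mxE eqxx mulr1n; apply: eq_bigr => k _; rewrite mxE.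
Qed.

(** A free family of k < n rows from X has a nonzero orthogonal vector, and a
member of X that is not orthogonal to it extends the family. *)
Lemma spanning_basis (R : realType) (n : nat) (X : set 'rV[R]_n) :
  spanning X -> exists A : 'M[R]_n, (forall i, X (row i A)) /\ \det A != 0.
Proof.
move=> Xspan.
suff {}H k : (k <= n)%N ->
    exists A : 'M[R]_(k, n), (forall i, X (row i A)) /\ row_free A.
  have [A [XA]] := H n (leqnn n).
  by rewrite row_free_unit unitmxE unitfE => detA; exists A.
elim: k => [_|k IHk kn].
  by exists 0; split=> [[]|] //; rewrite /row_free mxrank0.
have [A [XA Afree]] := IHk (ltnW kn).
have /rowV0Pn[x xA x0] : kermx A^T != 0.
  by rewrite kermx_eq0 /row_free neq_ltn (leq_ltn_trans (rank_leq_col _) kn).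
have [u [Xu ux]] : exists u, X u /\ dot u x != 0.
  apply: contrapT => H; case/eqP: x0; apply: Xspan => u Xu.
  by apply: contrapT => /eqP ux; apply: H; exists u.
have Ax : A *m x^T = 0.
  by move/sub_kermxP: xA => /(congr1 trmx); rewrite trmx_mul trmxK trmx0.
suff: exists B : 'M[R]_(1 + k, n), (forall i, X (row i B)) /\ row_free B by [].
exists (col_mx u A); split=> [i|].
  case: (split_ordP i) => j ->; first by rewrite rowKu row_id.
  by rewrite rowKd.
apply: inj_row_free => w; rewrite -[w]hsubmxK mul_row_col => E.
have := congr1 (mulmx^~ x^T) E.
rewrite mulmxDl -!mulmxA Ax mulmx0 addr0 mul0mx mulmx_tr_dot mul_mx_scalar.
move/eqP; rewrite scaler_eq0 (negbTE ux) /= => /eqP w0.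
move: E; rewrite w0 mul0mx add0r => /eqP.
by rewrite mulmx_free_eq0 // => /eqP ->; rewrite row_mx0.
Qed.

Definition coord_bounded (R : realType) (d : nat) (b : R) (K : set 'rV[R]_d) :=
  forall x, K x -> forall j, `|x 0 j| <= b.

Lemma det_bounded (R : realType) (n : nat) (b : R) :
  exists M, forall A : 'M[R]_n, (forall i j, `|A i j| <= b) -> `|\det A| <= M.
Proof.
exists (\sum_(s : 'S_n) \prod_(i < n) b) => A Ab.
apply: le_trans (ler_norm_sum _ _ _) _; apply: ler_sum => s _.
rewrite normrM normr_sign mul1r normr_prod; apply: ler_prod => i _.
by rewrite normr_ge0 Ab.
Qed.

(** By Cramer's rule the coordinate of u along row i is the quotient by \det A
of the determinant of A with row i replaced by u. This matrix also has its rows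
in X, so the quotient is at most 1 + e once |\det A| is within a factor 1 + e of
the supremum. *)
Lemma near_maximal_basis (R : realType) (n : nat) (X : set 'rV[R]_n) (b e : R) :
    spanning X -> coord_bounded b X -> 0 < e ->
  exists A : 'M[R]_n, (forall i, X (row i A)) /\
    forall u, X u -> exists t : 'rV[R]_n,
      u = t *m A /\ forall i, `|t 0 i| <= 1 + e.
Proof.
move=> Xspan Xb e_gt0.
have [A0 [XA0 detA0]] := spanning_basis Xspan.
pose E := [set `|\det A| | A in [set A : 'M[R]_n | forall i, X (row i A)]].
have Esup : has_sup E.
  split; first by exists `|\det A0|, A0.
  have [M HM] := det_bounded n b; exists M => _ [A XA <-]; apply: HM => i j.
  by have := Xb _ (XA i) j; rewrite mxE.
have supE A : (forall i, X (row i A)) -> `|\det A| <= sup E.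
  by move=> XA; apply: (sup_upper_bound Esup); exists A.
have sup_gt0 : 0 < sup E by apply: lt_le_trans (supE _ XA0); rewrite normr_gt0.
have e1_gt0 : 0 < 1 + e by rewrite addr_gt0.
have eps_gt0 : 0 < sup E * (e / (1 + e)) by rewrite mulr_gt0 // divr_gt0.
have [_ [A XA <-] ltA] := sup_adherent eps_gt0 Esup.
have {}ltA : sup E < (1 + e) * `|\det A|.
  rewrite -ltr_pdivrMl //; apply: le_lt_trans ltA.
  rewrite le_eqVlt; apply/orP; left; apply/eqP; field; exact: lt0r_neq0.
have detA : \det A != 0.
  by apply: contraTneq ltA => ->; rewrite normr0 mulr0 -leNgt ltW.
exists A; split=> // u Xu; exists ((\det A)^-1 *: (u *m \adj A)); split.
  by rewrite -scalemxAl -mulmxA mul_adj_mx mul_mx_scalar scalerA mulVf // scale1r.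
move=> i; pose B := \matrix_(j < n) (if j == i then u else row j A).
have -> : ((\det A)^-1 *: (u *m \adj A)) 0 i = (\det A)^-1 * \det B.
  rewrite mxE; congr (_ * _); rewrite mxE (expand_det_row B i).
  apply: eq_bigr => j _; rewrite mxE [B i j]mxE eqxx; congr (_ * _).
  rewrite /cofactor; congr (_ * \det _); apply/matrixP => k l.
  by rewrite !mxE eq_sym (negbTE (neq_lift _ _)) mxE.
rewrite normrM normfV ler_pdivrMl ?normr_gt0 // mulrC.
apply: le_trans (supE _ _) (ltW ltA) => j; rewrite rowK; case: ifP => // _; exact: XA.
Qed.

(** * Polar bodies *)

(** The homogenization of x: affine relations between points, and inequalities
with a constant term, become linear ones between homogenized points. *)
Definition homog (R : realType) (d : nat) (x : 'rV[R]_d) (s : R) : 'rV[R]_(d + 1) :=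
  row_mx x s%:M.

Lemma dot_homog (R : realType) (d : nat) (x y : 'rV[R]_d) (s t : R) :
  dot (homog x s) (homog y t) = dot x y + s * t.
Proof. by rewrite dot_row_mx /dot big_ord1 !mxE !eqxx !mulr1n. Qed.

Lemma homogP (R : realType) (d : nat) (w : 'rV[R]_(d + 1)) :
  exists x s, w = homog x s.
Proof. by exists (lsubmx w), (rsubmx w 0 0); rewrite /homog -mx11_scalar hsubmxK. Qed.

Lemma homog_inj (R : realType) (d : nat) (x y : 'rV[R]_d) (s t : R) :
  homog x s = homog y t -> x = y /\ s = t.
Proof.
by case/eq_row_mx => -> /matrixP/(_ 0 0); rewrite !mxE eqxx !mulr1n => ->.
Qed.

Lemma sum_homog (R : realType) (d : nat) (I : Type) (r : seq I) (c : I -> R)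
    (g : I -> 'rV[R]_d) (s : I -> R) :
  \sum_(i <- r) c i *: homog (g i) (s i) =
    homog (\sum_(i <- r) c i *: g i) (\sum_(i <- r) c i * s i).
Proof.
elim/big_rec3: _ => [|i x a w _ ->]; first by rewrite /homog raddf0 row_mx0.
by rewrite /homog scale_row_mx add_row_mx raddfD /= scale_scalar_mx.
Qed.

Lemma bounded_ray_eq0 (R : realType) (d : nat) (b : R) (K : set 'rV[R]_d) x :
  coord_bounded b K -> (forall t, 0 <= t -> K (t *: x)) -> x = 0.
Proof.
move=> Kb Kx; apply/rowP => j; rewrite mxE; apply/eqP; rewrite -normr_le0 leNgt.
apply/negP => xj; have b_ge0 : 0 <= b.
  by apply: le_trans (Kb _ (Kx 0 (lexx 0)) j); rewrite normr_ge0.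
have t_ge0 : 0 <= (b + 1) / `|x 0 j| by rewrite divr_ge0 // addr_ge0.
have := Kb _ (Kx _ t_ge0) j.
by rewrite mxE normrM ger0_norm // divfK ?gt_eqF // gerDl ler10.
Qed.

Section Polar.
Variables (R : realType) (d : nat) (I : finType).
Implicit Types (f : I -> 'rV[R]_d) (x z : 'rV[R]_d) (b e : R).

Definition polar f : set 'rV[R]_d := [set x | forall i, dot (f i) x <= 1].

Lemma polar0 f : polar f 0.
Proof. by move=> i; rewrite dot0r. Qed.

Lemma polar_absorbing f x : exists2 t, 0 < t & polar f (t *: x).
Proof.
have S_ge0 : 0 <= \sum_i `|dot (f i) x| by apply: sumr_ge0.
have S1_gt0 : 0 < 1 + \sum_i `|dot (f i) x| by rewrite ltr_pwDl.
exists (1 + \sum_i `|dot (f i) x|)^-1; first by rewrite invr_gt0.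
move=> i; rewrite dotZr ler_pdivrMl // mulr1 (le_trans (ler_norm _)) //.
rewrite (bigD1 i) //= addrCA lerDl addr_ge0 // sumr_ge0 //.
Qed.

(** The point z is the centroid of a simplex s_0, ..., s_d in the polar body, of
nearly maximal volume. If x = sum t_i s_i with sum t_i = 1 and t_i <= 1 + e,
then the barycentric coordinates of z - (x - z) / D are
((1 + 1 / D) / (d + 1) - t_i / D). They are nonnegative as
(D + 1) / (d + 1) = 1 + e: this is where the value of D comes from. *)
Lemma near_center f b e : coord_bounded b (polar f) ->
    0 < e -> let D := d%:R + e * d.+1%:R in
  exists2 z, polar f z & forall x, polar f x -> polar f (z - D^-1 *: (x - z)).
Proof.
move=> fb e_gt0 D.
pose X := [set homog k 1 | k in polar f].
have Xspan : spanning X.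
  move=> w; have [x [s ->]] := homogP w => H.
  have E k : polar f k -> dot k x + s = 0.
    by move=> fk; rewrite -[s]mul1r -dot_homog; apply: H; exists k.
  have s0 : s = 0 by rewrite -(E 0 (polar0 f)) dotC dot0r add0r.
  have [t t_gt0 /E] := polar_absorbing f x.
  rewrite s0 addr0 dotZl => /eqP; rewrite mulf_eq0 gt_eqF //= => /eqP xx.
  have [->|/dotvv_gt0] := eqVneq x 0; first by rewrite /homog raddf0 row_mx0.
  by rewrite xx ltxx.
have Xb u : X u -> forall j, `|u 0 j| <= `|b| + 1.
  case=> k fk <- j; rewrite /homog; case: (split_ordP j) => l ->.
    rewrite row_mxEl (le_trans (fb _ fk l)) // (le_trans (ler_norm b)) //.
    by rewrite lerDl.
  by rewrite row_mxEr ord1 mxE eqxx normr1 lerDr.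
have [A [XA AX]] := near_maximal_basis Xspan Xb e_gt0.
have /choice[s sA] : forall i, exists k, polar f k /\ row i A = homog k 1.
  by move=> i; have [k fk] := XA i; exists k.
have N_gt0 : 0 < d.+1%:R :> R by rewrite ltr0n.
have D_gt0 : 0 < D by rewrite ltr_wpDl ?ler0n // mulr_gt0.
have cardN : \sum_(i < d + 1) 1 = d.+1%:R :> R.
  by rewrite sumr_const card_ord addn1.
pose z := d.+1%:R^-1 *: \sum_i s i.
have zE v : dot v z = \sum_i d.+1%:R^-1 * dot v (s i).
  by rewrite dotZr dot_sumr mulr_sumr.
have convK i0 (q : 'I_(d + 1) -> R) : (forall i, 0 <= q i) -> \sum_i q i = 1 ->
    \sum_i q i * dot (f i0) (s i) <= 1.
  move=> q_ge0 q1; rewrite -[leRHS]q1; apply: ler_sum => i _.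
  by rewrite ler_piMr // (proj1 (sA i)).
exists z => [i0|x fx i0].
  rewrite zE; apply: convK => [i|]; first by rewrite invr_ge0 ltW.
  rewrite -[RHS](mulVf (lt0r_neq0 N_gt0)) -cardN mulr_sumr.
  by under [RHS]eq_bigr do rewrite mulr1.
have [t [tA tb]] : exists t : 'rV[R]_(d + 1), homog x 1 = t *m A /\
    forall i, `|t 0 i| <= 1 + e by apply: AX; exists x.
have [xt t1] : x = \sum_i t 0 i *: s i /\ 1 = \sum_i t 0 i.
  have : homog x 1 = homog (\sum_i t 0 i *: s i) (\sum_i t 0 i * 1).
    rewrite -sum_homog tA mulmx_sum_row; apply: eq_bigr => i _.
    by rewrite (proj2 (sA i)).
  by move=> /homog_inj[? ->]; split=> //; under eq_bigr do rewrite mulr1.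
rewrite dotDr dotNr (dotZr D^-1) dotDr dotNr zE.
have -> : \sum_i d.+1%:R^-1 * dot (f i0) (s i) -
      D^-1 * (dot (f i0) x - \sum_i d.+1%:R^-1 * dot (f i0) (s i)) =
    \sum_i ((1 + D^-1) / d.+1%:R - D^-1 * t 0 i) * dot (f i0) (s i).
  have -> : dot (f i0) x = \sum_i t 0 i * dot (f i0) (s i).
    by rewrite xt dot_sumr; apply: eq_bigr => i _; rewrite dotZr.
  rewrite mulrBr !mulr_sumr opprB addrA -big_split -sumrB.
  by apply: eq_bigr => i _ /=; ring.
apply: convK => [i|].
  rewrite -(ler_pM2l D_gt0) mulr0 mulrBr !mulrA mulfV ?gt_eqF // mul1r.
  rewrite mulrDr mulr1 mulfV ?gt_eqF //.
  have -> : (D + 1) / d.+1%:R = 1 + e.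
    by rewrite /D -natr1; field; rewrite natr1 gt_eqF.
  by rewrite subr_ge0 (le_trans (ler_norm _)).
rewrite sumrB -[X in _ - X]mulr_sumr -t1 -[X in X - _ = _]mulr_sumr.
rewrite (_ : \sum_(i < d + 1) _ = d.+1%:R / d.+1%:R); last first.
  by rewrite -cardN mulr_suml; apply: eq_bigr => i _; rewrite mul1r.
by rewrite mulfV ?gt_eqF // !mulr1 addrK.
Qed.

(** One group of d inequalities bounds the products of x - z with a nearly
maximal basis w_1, ..., w_d from above. A second group, found through - (w_1 +
... + w_d), bounds the sum of these products from below. Together they control
every vector whose coordinates in the basis are bounded. *)
Lemma sparse_polar f b e : coord_bounded b (polar f) ->
    0 < e -> (0 < d)%N ->
    let C := (1 + e) * d%:R * (d%:R + e * d.+1%:R + 2) in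
  exists J : {set I}, (#|J| <= 2 * d)%N /\
    exists2 z, polar f z & forall x, (forall i, i \in J -> dot (f i) x <= 1) ->
      exists2 k, polar f k & x = z + C *: (k - z).
Proof.
move=> fb e_gt0 d_gt0; set D := d%:R + e * d.+1%:R; move=> C.
have [z fz zsym] := near_center fb e_gt0; rewrite -/D in zsym.
have d_gt0R : 0 < d%:R :> R by rewrite ltr0n.
have D_gt0 : 0 < D by rewrite addr_gt0 // mulr_gt0 // ltr0n.
have C_gt0 : 0 < C by rewrite !mulr_gt0 // addr_gt0.
(* The near symmetry, applied to x = 0, gives <f i, z> (1 + 1 / D) <= 1, so z
   is an interior point. *)
have a_gt0 i : 0 < 1 - dot (f i) z.
  have := zsym 0 (polar0 f) i; rewrite sub0r scalerN opprK dotDr dotZr.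
  rewrite subr_gt0 -[X in X + _]mul1r -mulrDl => H.
  have D1 : 1 < 1 + D^-1 by rewrite ltrDl invr_gt0.
  have [zi|zi] := leP (dot (f i) z) 0; first exact: le_lt_trans ltr01.
  by apply: lt_le_trans H; rewrite ltr_pMl.
pose g i := (1 - dot (f i) z)^-1 *: f i.
have gP i x : (dot (g i) x <= 1) = (dot (f i) (z + x) <= 1).
  by rewrite dotZl ler_pdivrMl // mulr1 dotDr lerBrDl.
have gray x : (forall i, dot (g i) x <= 0) -> x = 0.
  move=> gx; apply: (bounded_ray_eq0 fb) => t t_ge0 i.
  apply: (@le_trans _ _ 0) => //; rewrite dotZr mulr_ge0_le0 //.
  by have := gx i; rewrite dotZl pmulr_rle0 ?invr_gt0.
have gspan : spanning (range g).
  by move=> x H; apply: gray => i; rewrite H //; exists i.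
have [b' gb] : exists b', forall u, range g u -> forall j, `|u 0 j| <= b'.
  exists (\sum_i \sum_j `|g i 0 j|) => _ [i _ <-] j.
  rewrite (bigD1 i) //= (bigD1 j) //= -addrA lerDl addr_ge0 ?sumr_ge0 // => k _.
  exact: sumr_ge0.
have [A [XA AX]] := near_maximal_basis gspan gb e_gt0.
have /choice[w wA] : forall j, exists i, row j A = g i.
  by move=> j; have [i _ Ei] := XA j; exists i.
pose y := - \sum_j g (w j).
have yD x : (forall i, dot (g i) x <= 1) -> dot y x <= d%:R * D.
  move=> gx; rewrite dotNl -dotNr dot_suml mulr_natl -[X in _ <= _ *+ X]card_ord.
  rewrite -sumr_const; apply: ler_sum => j _.
  have fzx : polar f (z + x) by move=> i; rewrite -gP.
  have := zsym _ fzx (w j); rewrite [z + x]addrC addrK -scalerN -gP dotZr.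
  by rewrite ler_pdivrMl // mulr1.
have [c [c_ge0 yc cD]] : exists c : I -> R,
    [/\ forall i, 0 <= c i, y = \sum_i c i *: g i & \sum_i c i <= d%:R * D].
  (* The extra vector homog 0 1 is the slack that turns the bound on the sum of
     the coefficients into an equality. *)
  pose F (o : option I) := if o is Some i then homog (g i) 1 else homog 0 1.
  have [[c [c_ge0 Ey]]|[x' [Fx yx]]] := farkas F (homog y (d%:R * D)).
    have sum_option (V : nmodType) (G : option I -> V) :
        \sum_o G o = G None + \sum_i G (Some i).
      rewrite (bigD1 None) //=; congr (_ + _).
      rewrite (reindex_omap Some id) //=; first by apply: eq_bigl => i; rewrite eqxx.
      by case.
    move: Ey; rewrite sum_option /= sum_homog scale_row_mx add_row_mx scaler0 add0r.
    rewrite scale_scalar_mx -raddfD /= mulr1 => /homog_inj[Ey ED].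
    exists (c \o Some); split=> //=; rewrite ED.
    by under [X in _ <= _ + X]eq_bigr do rewrite mulr1; rewrite lerDr.
  exfalso; have [x [s Ex]] := homogP x'; rewrite {x'}Ex in Fx yx.
  have s_le0 : s <= 0.
    by have := Fx None; rewrite /= dot_homog dotC dot0r add0r mul1r.
  have gx i : dot (g i) x + s <= 0.
    by have := Fx (Some i); rewrite /= dot_homog mul1r.
  rewrite dot_homog in yx.
  move: s_le0; rewrite le_eqVlt => /predU1P[s0|s_lt0].
    have x0 : x = 0 by apply: gray => i; have := gx i; rewrite s0 addr0.
    by move: yx; rewrite x0 s0 dot0r mulr0 addr0 ltxx.
  have s'_gt0 : 0 < - s by rewrite oppr_gt0.
  have /yD : forall i, dot (g i) ((- s)^-1 *: x) <= 1.
    by move=> i; rewrite dotZr ler_pdivrMl // mulr1 -subr_le0 opprK.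
  rewrite dotZr ler_pdivrMl // mulNr mulrC -subr_le0 opprK.
  by rewrite leNgt yx.
have [c' [c'_ge0 yc' cc' c'card]] := conic_caratheodory g c_ge0.
have {cc'}cD' := le_trans cc' cD; rewrite -yc in yc'.
exists ([set w j | j in 'I_d] :|: [set i | c' i != 0])%SET; split.
  rewrite (leq_trans (leq_card_setU _ _)) // mul2n -addnn leq_add //.
    by rewrite (leq_trans (leq_imset_card _ _)) // card_ord.
  by rewrite cardsE.
exists z => // x Jx; pose xi := x - z.
have gx i : i \in ([set w j | j in 'I_d] :|: [set i | c' i != 0])%SET ->
    dot (g i) xi <= 1.
  by move=> iJ; rewrite gP addrC subrK Jx.
have wx j : dot (g (w j)) xi <= 1.
  by apply: gx; rewrite finset.in_setU imset_f.
have swx : - (d%:R * D) <= \sum_j dot (g (w j)) xi.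
  rewrite lerNl -dot_suml -dotNl -/y -yc' dot_suml.
  apply: le_trans cD'; apply: ler_sum => i _; rewrite dotZl.
  have [->|ci] := eqVneq (c' i) 0; first by rewrite mul0r.
  by rewrite ler_piMr // gx // finset.in_setU inE ci orbT.
have gC i : dot (g i) xi <= C.
  have [t [gt tb]] : exists t : 'rV[R]_d, g i = t *m A /\
    forall j, `|t 0 j| <= 1 + e by apply: AX; exists i.
  (* Shifting the coefficients t_j by 1 + e makes them nonnegative, so that the
     upper bounds wx apply; swx bounds the correction. *)
  have -> : dot (g i) xi = \sum_j (t 0 j + (1 + e)) * dot (g (w j)) xi
      - (1 + e) * \sum_j dot (g (w j)) xi.
    rewrite gt mulmx_sum_row dot_suml mulr_sumr -sumrB; apply: eq_bigr => j _.
    by rewrite wA dotZl; ring.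
  have -> : C = \sum_(j < d) (1 + e + (1 + e)) - (1 + e) * - (d%:R * D).
    by rewrite sumr_const card_ord -mulr_natl /C; ring.
  apply: lerB; last by rewrite ler_pM2l // addr_gt0.
  apply: ler_sum => j _; have := tb j; rewrite ler_norml => /andP[t1 t2].
  apply: (@le_trans _ _ (t 0 j + (1 + e))); last by rewrite lerD2r.
  by rewrite ler_piMr // -[1 + e]opprK subr_ge0.
exists (z + C^-1 *: xi).
  by move=> i; rewrite -gP dotZr ler_pdivrMl // mulr1.
by rewrite (addrC z (C^-1 *: xi)) addrK scalerA mulfV ?gt_eqF // scale1r addrC subrK.
Qed.

End Polar.

(** * Convex hulls of finite sets and their vertices *)

Section Hull.
Variables (R : realType) (d : nat).
Implicit Types (A : set 'rV[R]_d) (V : {fset 'rV[R]_d}).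

Lemma convex_setP A : @convex_set R 'rV[R]_d A <->
  forall x y t, 0 <= t -> t <= 1 -> A x -> A y -> A (t *: x + (1 - t) *: y).
Proof.
split=> [cA x y t t0 t1 Ax Ay|cA x y l].
  by have := cA x y (Itv01 t0 t1); rewrite !inE; apply.
by rewrite !inE => Ax Ay; apply: cA.
Qed.

Lemma convex_hull_convex A : @convex_set R 'rV[R]_d (convex_hull A).
Proof.
apply/convex_setP => x y t t0 t1 Ax Ay C [cC AC].
have /convex_setP := cC; apply=> //; [exact: Ax | exact: Ay].
Qed.

Lemma convex_comb_mem A (s : seq 'rV[R]_d) (c : 'rV[R]_d -> R) :
    @convex_set R 'rV[R]_d A -> {in s, forall u, A u} -> (forall u, 0 <= c u) ->
  0 < \sum_(u <- s) c u ->
  A ((\sum_(u <- s) c u)^-1 *: \sum_(u <- s) c u *: u).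
Proof.
move=> /convex_setP cA + c_ge0; elim: s => [|u s IHs] As; first by rewrite big_nil ltxx.
have S_ge0 : 0 <= \sum_(v <- s) c v by apply: sumr_ge0.
have Au : A u by apply: As; rewrite mem_head.
have {}As : {in s, forall v, A v} by move=> v vs; apply: As; rewrite inE vs orbT.
rewrite !big_cons; move: S_ge0; rewrite le_eqVlt => /predU1P[/esym S0|S_gt0].
  rewrite S0 addr0 => cu.
  suff -> : \sum_(v <- s) c v *: v = 0.
    by rewrite addr0 scalerA mulVf ?gt_eqF // scale1r.
  rewrite big_seq big1 // => v vs; move/eqP: S0; rewrite psumr_eq0 // => /allP/(_ v vs).
  by move=> /eqP ->; rewrite scale0r.
move=> T_gt0; set T := c u + _ in T_gt0 *.
have -> : T^-1 *: (c u *: u + \sum_(v <- s) c v *: v) =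
    (c u / T) *: u +
    (1 - c u / T) *: ((\sum_(v <- s) c v)^-1 *: \sum_(v <- s) c v *: v).
  rewrite scalerDr !scalerA; congr (_ *: _ + _ *: _); first by rewrite mulrC.
  by rewrite /T; field; rewrite !gt_eqF.
apply: cA => //; last exact: IHs.
  by rewrite divr_ge0 // ltW.
by rewrite ler_pdivrMr // mul1r lerDl ltW.
Qed.

Lemma convex_hullP V p : convex_hull [set` V] p <->
  exists c : 'rV[R]_d -> R, [/\ forall u, 0 <= c u, \sum_(u <- V) c u = 1
     & p = \sum_(u <- V) c u *: u].
Proof.
split=> [|[c [c_ge0 c1 ->]]].
  pose combs := [set p | exists c : 'rV[R]_d -> R,
    [/\ forall u, 0 <= c u, \sum_(u <- V) c u = 1
      & p = \sum_(u <- V) c u *: u]].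
  apply: (@smallest_sub _ (@convex_set R _) [set` V] combs) => [|v /= vV].
    apply/convex_setP => _ _ t t0 t1 [a [a_ge0 a1 ->]] [b [b_ge0 b1 ->]].
    exists (fun u => t * a u + (1 - t) * b u); split.
    - by move=> u; rewrite addr_ge0 // mulr_ge0 // subr_ge0.
    - by rewrite big_split /= -!mulr_sumr a1 b1 !mulr1 addrC subrK.
    - rewrite !scaler_sumr -big_split; apply: eq_bigr => u _.
      by rewrite /= !scalerA -scalerDl.
  exists (fun u => (u == v)%:R); split=> //.
    rewrite (big_fsetD1 v vV) /= eqxx big_seq big1 ?addr0 // => u.
    by rewrite !inE => /andP[/negbTE->].
  rewrite (big_fsetD1 v vV) /= eqxx scale1r big_seq big1 ?addr0 // => u.
  by rewrite !inE => /andP[/negbTE->]; rewrite scale0r.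
have := @convex_comb_mem (convex_hull [set` V]) V c.
rewrite c1 invr1 scale1r; apply=> //; first exact: convex_hull_convex.
by move=> u uV; apply: sub_gen_smallest.
Qed.

Lemma convex_hull_halfspace V p x (s : R) :
  (forall v, v \in V -> dot v x <= s) -> convex_hull [set` V] p -> dot p x <= s.
Proof.
move=> Vx /convex_hullP[c [c_ge0 c1 ->]].
rewrite dot_suml -[s]mul1r -c1 mulr_suml big_seq [leRHS]big_seq.
by apply: ler_sum => v vV; rewrite dotZl ler_wpM2l ?Vx.
Qed.

(** If v = t y + (1 - t) z, the coefficients of y and z on v average to that of
v. If this average were less than 1, one could solve for v as a convex
combination of the other points of V; hence it is 1 and y = z = v. *)
Lemma irredundant_vertex V v :
    v \in V -> ~ convex_hull [set` (V `\ v)%fset] v ->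
  vertices (convex_hull [set` V]) v.
Proof.
move=> vV Nv; split=> [|y z t]; first exact: sub_gen_smallest.
move=> /convex_hullP[a [a_ge0 a1 Ey]] /convex_hullP[b [b_ge0 b1 Ez]].
move=> /andP[t_gt0 t_lt1] Ev.
have t'_gt0 : 0 < 1 - t by rewrite subr_gt0.
have le1 (c : 'rV[R]_d -> R) : (forall u, 0 <= c u) ->
    \sum_(u <- V) c u = 1 -> c v <= 1.
  by move=> c_ge0 <-; rewrite (big_fsetD1 v vV) /= lerDl sumr_ge0.
have eq1 (c : 'rV[R]_d -> R) : (forall u, 0 <= c u) ->
    \sum_(u <- V) c u = 1 -> c v = 1 ->
    \sum_(u <- V) c u *: u = v.
  move=> c_ge0; rewrite !(big_fsetD1 v vV) /= => c1 cv; rewrite cv scale1r.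
  rewrite big_seq big1 ?addr0 // => u uV.
  move: c1; rewrite cv => /(canRL (addKr _)); rewrite addNr => /eqP.
  by rewrite psumr_eq0 // => /allP/(_ u uV)/eqP ->; rewrite scale0r.
pose c u := t * a u + (1 - t) * b u.
have c_ge0 u : 0 <= c u by rewrite addr_ge0 // mulr_ge0 // ltW.
have c1 : \sum_(u <- V) c u = 1.
  by rewrite big_split /= -!mulr_sumr a1 b1 !mulr1 addrC subrK.
have Ec : v = \sum_(u <- V) c u *: u.
  rewrite {1}Ev Ey Ez !scaler_sumr -big_split; apply: eq_bigr => u _.
  by rewrite /= !scalerA -scalerDl.
have cv : c v = 1.
  apply/eqP; rewrite eq_le le1 //= leNgt; apply/negP => cv_lt1; apply: Nv.
  move: c1 Ec; rewrite !(big_fsetD1 v vV) /= => /(canRL (addKr _)) S Ec.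
  rewrite addrC in S.
  have Ev' : \sum_(u <- (V `\ v)%fset) c u *: u =
      (\sum_(u <- (V `\ v)%fset) c u) *: v.
    by rewrite S scalerBl scale1r; apply/esym/eqP; rewrite subr_eq {1}Ec addrC.
  have S_gt0 : 0 < \sum_(u <- (V `\ v)%fset) c u by rewrite S subr_gt0.
  rewrite -[X in convex_hull _ X]scale1r -(mulVf (lt0r_neq0 S_gt0)) -scalerA -Ev'.
  apply: (@convex_comb_mem (convex_hull [set` (V `\ v)%fset])) => //.
    exact: convex_hull_convex.
  by move=> u uV; apply: sub_gen_smallest.
have [av bv] : a v = 1 /\ b v = 1.
  have av := le1 a a_ge0 a1; have bv := le1 b b_ge0 b1.
  move: cv; rewrite /c => cv; split; apply/eqP; rewrite eq_le ?av ?bv /=; nra.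
by rewrite Ey Ez !eq1.
Qed.

(** Discard redundant points one by one: when none is left, all the remaining
ones are vertices. *)
Lemma convex_hull_vertices V : exists W : {fset 'rV[R]_d},
  convex_hull [set` W] = convex_hull [set` V] /\
  [set` W] `<=` vertices (convex_hull [set` V]).
Proof.
have [k] := ubnP #|` V|; elim: k V => // k IHk V Vk.
have [[v [vV hv]]|H] :=
    pselect (exists v, v \in V /\ convex_hull [set` (V `\ v)%fset] v); last first.
  exists V; split=> // v vV; apply: irredundant_vertex => // hv.
  by apply: H; exists v.
suff <- : convex_hull [set` (V `\ v)%fset] = convex_hull [set` V].
  by apply: IHk; rewrite -ltnS (leq_trans _ Vk) // ltnS (cardfsD1 v V) vV.
apply/seteqP; split.
  apply: sub_smallest2r => [|u /=]; first exact: convex_hull_convex.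
  by rewrite !inE => /andP[].
apply: smallest_sub; first exact: convex_hull_convex.
move=> u /= uV; have [->//|uv] := eqVneq u v.
by apply: sub_gen_smallest; rewrite /= !inE uv.
Qed.

End Hull.

(** * Balls inside convex hulls *)

Section Ball.
Variables (R : realType) (d : nat).

Lemma euclidean_normE (x : 'rV[R]_d) : euclidean_norm x = Num.sqrt (dot x x).
Proof. by congr Num.sqrt; apply: eq_bigr => j _; rewrite expr2. Qed.

Lemma euclidean_ballN (x : 'rV[R]_d) : euclidean_ball R d x -> euclidean_ball R d (- x).
Proof.
by rewrite /euclidean_ball /= !euclidean_normE dotNl dotNr opprK.
Qed.

Lemma euclidean_ball_delta j : euclidean_ball R d (delta_mx 0 j).
Proof.
by rewrite /euclidean_ball /= euclidean_normE dot_delta mxE !eqxx sqrtr1.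
Qed.

Lemma coord_bounded_of_ball (r : R) (K : set 'rV[R]_d) : 0 < r ->
  (forall x, K x -> forall p, euclidean_ball R d p -> r * dot p x <= 1) ->
  coord_bounded r^-1 K.
Proof.
move=> r_gt0 Kr x Kx j.
have Hx p : euclidean_ball R d p -> dot p x <= r^-1.
  by move=> Bp; rewrite -(ler_pM2l r_gt0) mulfV ?gt_eqF // Kr.
have Bj := euclidean_ball_delta j.
rewrite ler_norml lerNl -dot_delta dotC -dotNl !Hx //.
exact: euclidean_ballN.
Qed.

(** A point r q outside of the hull is cut off by some (x, s) with
<v, x> + s <= 0 < <r q, x> + s for v in V. For s < 0, x / (- s) contradicts the
bound on the polar of V. For s >= 0, the ray through x lies in this polar, which
is bounded, so x = 0; then V is empty, whose polar is unbounded. *)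
Lemma ball_sub_convex_hull (r : R) (V : {fset 'rV[R]_d}) : (0 < d)%N -> 0 < r ->
    (forall x, (forall v, v \in V -> dot v x <= 1) ->
       forall p, euclidean_ball R d p -> r * dot p x <= 1) ->
  dilate r (euclidean_ball R d) `<=` convex_hull [set` V].
Proof.
move=> d_gt0 r_gt0 Vr _ [q Bq <-].
have Vray x : (forall v, v \in V -> dot v x <= 0) -> x = 0.
  move=> Vx; apply: (bounded_ray_eq0 (coord_bounded_of_ball r_gt0 Vr)) => t t_ge0 v vV.
  by rewrite dotZr (@le_trans _ _ 0) // mulr_ge0_le0 // Vx.
have := farkas_seq (fun v => homog v 1) (homog (r *: q) 1) (fset_uniq V).
case=> [[c [c_ge0 Ec]]|[x' [Vx qx]]].
  move: Ec; rewrite sum_homog => /homog_inj[Eq E1].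
  apply/convex_hullP; exists c; split=> //; rewrite E1.
  by under [RHS]eq_bigr do rewrite mulr1.
exfalso; have [x [s Ex]] := homogP x'; rewrite {x'}Ex dot_homog mul1r in Vx qx.
have {}Vx v : v \in V -> dot v x + s <= 0.
  by move=> vV; have := Vx v vV; rewrite dot_homog mul1r.
have [s_lt0|s_ge0] := ltP s 0.
  have s'_gt0 : 0 < - s by rewrite oppr_gt0.
  have /Vr/(_ q Bq) : forall v, v \in V -> dot v ((- s)^-1 *: x) <= 1.
    by move=> v vV; rewrite dotZr ler_pdivrMl // mulr1 -subr_le0 opprK Vx.
  rewrite dotZr mulrCA -dotZl ler_pdivrMl // mulr1 -subr_le0 opprK leNgt qx //.
have x0 : x = 0.
  by apply: Vray => v /Vx; apply: le_trans; rewrite lerDl.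
rewrite x0 dot0r add0r in qx.
have V0 v : v \notin V.
  by apply/negP => /Vx; rewrite x0 dot0r add0r leNgt qx.
have /rowP/(_ (Ordinal d_gt0)) : delta_mx 0 (Ordinal d_gt0) = 0 :> 'rV[R]_d.
  by apply: Vray => v; rewrite (negbTE (V0 v)).
by rewrite !mxE !eqxx => /eqP; rewrite oner_eq0.
Qed.

End Ball.

(** * Few vertices with a large ball in their hull *)

Theorem corollary1p4 (R : realType) (d : nat) (hd : (0 < d)%N)
    (Q : set 'rV[R]_d) (hQ : polytope Q) (hB : euclidean_ball R d `<=` Q) :
  exists V : {fset 'rV[R]_d},
    [/\ [set` V] `<=` vertices Q,
        (#|` V| <= 2 * d)%N
      & dilate (d%:R `^ (- (5 / 2)) / 7) (euclidean_ball R d)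
          `<=` convex_hull [set` V]].
Proof.
have [V0 EQ] := hQ; have [W [EW Wvert]] := convex_hull_vertices V0.
rewrite -EQ in EW Wvert.
pose f (v : W) : 'rV[R]_d := val v.
have ball_polar x : polar f x -> forall p, euclidean_ball R d p -> dot p x <= 1.
  move=> fx p /hB; rewrite -EW; apply: convex_hull_halfspace => v vW.
  exact: (fx [` vW]%fset).
have fb : coord_bounded 1^-1 (polar f).
  by apply: coord_bounded_of_ball => // x fx p Bp; rewrite mul1r ball_polar.
have e_gt0 : 0 < 10^-1 :> R by rewrite invr_gt0.
have [J [Jcard [z fz HJ]]] := sparse_polar fb e_gt0 hd.
set C := _ * _ in HJ.
have n_ge1 : 1 <= d%:R :> R by rewrite ler1n.
have CE : C = (121 * d%:R ^+ 2 + 231 * d%:R) / 100 by rewrite /C -natr1; field.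
have n2_ge0 : 0 <= (d%:R - 1) ^+ 2 :> R by rewrite sqr_ge0.
have C_ge1 : 1 <= C by rewrite CE; lra.
have C_le : 2 * C - 1 <= 7 * d%:R ^+ 2 by rewrite CE; lra.
set r := _ / 7.
have r_gt0 : 0 < r by rewrite divr_gt0 // powR_gt0 // (lt_le_trans ltr01).
have rC : r * (2 * C - 1) <= 1.
  apply: (@le_trans _ _ (r * (7 * d%:R ^+ 2))); first by rewrite ler_pM2l.
  rewrite /r mulrA divfK // -ler_pdivlMr ?exprn_gt0 ?(lt_le_trans ltr01) //.
  rewrite mul1r -powR_invn ?ler0n //; apply: ler_powR => //; lra.
have [V VE Vcard] : exists2 V : {fset 'rV[R]_d},
    V =i [seq f i | i <- enum J] & (#|` V| <= 2 * d)%N.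
  exists (seq_fset tt [seq f i | i <- enum J]); first exact: seq_fsetE.
  by rewrite size_seq_fset (leq_trans (size_undup _)) // size_map -cardE.
exists V; split=> //.
  by move=> v /=; rewrite VE => /mapP[i _ ->]; apply: Wvert; exact: valP.
apply: ball_sub_convex_hull => // x Jx p Bp.
have [|k fk ->] := HJ x.
  by move=> i iJ; apply: Jx; rewrite VE map_f // mem_enum.
have pk : dot p k <= 1 by apply: ball_polar.
have pz : - dot p z <= 1 by rewrite -dotNl ball_polar //; apply: euclidean_ballN.
apply: le_trans rC; rewrite ler_pM2l // dotDr dotZr dotDr dotNr; nra.
Qed.
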